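(* Let $p^*\in\mathcal P(\mathcal X)$ be a probability distribution, let $\mathcal M\subseteq\{0,1\}^D$ be a family of masks (observed index sets), and let $\mu\in\mathcal P(\mathcal M)$ be a positive probability distribution on $\mathcal M$, i.e. $\mu(m)>0$ for every $m\in\mathcal M$. Define $$\mathcal C:=\{q\in\mathcal P(\mathcal X): q_m=p_m^*\ \text{ for all } m\in\mathcal M\}.$$ Let $p^0\in\mathcal P(\mathcal X)$ be such that there exists $r\in\mathcal C$ with $\mathrm{KL}(r\,\|\,p^0)<\infty$, and define iteratively, for $n\ge 0$, $$p^{n+1}(x)=\mathbb E_{m\sim\mu}\left[p_m^*(x_m)\,p^n(\overline{x}_m\mid x_m)\right]=\sum_{m\in\mathcal M}\mu(m)\,p_m^*(x_m)\,p^n(\overline{x}_m\mid x_m).$$ Then, for every $m\in\mathcal M$, $$\mathrm{KL}(p_m^*\,\|\,p_m^n)\to 0\qquad\text{as } n\to\infty.$$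
   Context: The data space is $\mathcal X=\mathbb R^{d_1}\times\prod_{\ell=1}^{d_2}\mathcal S_\ell$, where each $\mathcal S_\ell$ is a finite discrete set, and $D=d_1+d_2$; a point is written $x=(x^{(1)},\dots,x^{(D)})$. $\mathcal P(\mathcal X)$ is the set of probability distributions on $\mathcal X$. A mask is a vector $m\in\{0,1\}^D$; $m_j=1$ means coordinate $j$ is observed and $m_j=0$ means it is missing. Write $x_m=\{x^{(j)}:m_j=1\}$ for the observed coordinates and $\overline{x}_m=\{x^{(j)}:m_j=0\}$ for the missing coordinates. For $p\in\mathcal P(\mathcal X)$, $p_m$ denotes the marginal distribution of $p$ on the coordinates $x_m$, and $p(\overline{x}_m\mid x_m)$ denotes the (regular) conditional distribution under $p$ of the missing coordinates given the observed ones. The expression $p_m^*(x_m)\,p(\overline{x}_m\mid x_m)$ denotes the probability distribution on $\mathcal X$ obtained by drawing $x_m\sim p_m^*$ and then $\overline{x}_m\sim p(\cdot\mid x_m)$; the expectation over $m\sim\mu$ is the corresponding finite mixture of these distributions. In the update, $p_m^n$ and $p^n(\overline{x}_m\mid x_m)$ are the marginal and conditional of $p^n$. $\mathrm{KL}(q\,\|\,p)=\int \log\frac{dq}{dp}\,dq$ if $q\ll p$, and $+\infty$ otherwise. *)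

(* Defs.v *)
From HB Require Import structures.
From mathcomp Require Import all_boot all_order all_algebra.
From mathcomp Require Import all_classical all_reals all_analysis.

Set Implicit Arguments.
Unset Strict Implicit.
Unset Printing Implicit Defensive.
Import Order.TTheory GRing.Theory Num.Theory.
Import numFieldNormedType.Exports.

Local Open Scope classical_set_scope.
Local Open Scope ring_scope.
Local Open Scope ereal_scope.
Local Open Scope charge_scope.

Definition prod_space (I : Type) (d : measure_display)
  (T : I -> measurableType d) : Type := forall i, T i.

Definition prod_space_display (d : measure_display) : measure_display.
Proof. exact d. Qed.

Section prod_space.
Context (I : Type) (d : measure_display) (T : I -> measurableType d).

Definition prod_space_measurable : set (set (prod_space T)) :=
  <<s \bigcup_i preimage_set_system [set: prod_space T] (fun x => x i) measurable >>.

Let prod_space0 : prod_space_measurable set0.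
Proof. exact: sigma_algebra0. Qed.

Let prod_spaceC A : prod_space_measurable A -> prod_space_measurable (~` A).
Proof. by move=> mA; rewrite -setTD; exact: sigma_algebraCD. Qed.

Let prod_space_bigcup (F : (set (prod_space T))^nat) :
  (forall i, prod_space_measurable (F i)) ->
  prod_space_measurable (\bigcup_i F i).
Proof. exact: sigma_algebra_bigcup. Qed.

HB.instance Definition _ := Pointed.copy (prod_space T) (forall i, T i).
HB.instance Definition _ := @isMeasurable.Build (prod_space_display d)
  (prod_space T) prod_space_measurable prod_space0 prod_spaceC prod_space_bigcup.

End prod_space.

Section restriction.
Context (I : Type) (d : measure_display) (T : I -> measurableType d).

Definition sub_space (P : pred I) : measurableType (prod_space_display d) :=
  Measurable.clone _ (prod_space (fun j : {j | P j} => T (sval j))) _.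

Definition restrict_sub (P : pred I) (x : prod_space T) : sub_space P :=
  fun j => x (sval j).

Lemma measurable_restrict_sub (P : pred I) : measurable_fun setT (@restrict_sub P).
Proof.
apply: (@measurability _ _ _ _ _ _ (\bigcup_j preimage_set_system
  [set: sub_space P] (fun x => x j) measurable)) => //.
move=> _ [_ [j _ [A mA <-]] <-]; rewrite !setTI.
apply: sub_sigma_algebra; exists (sval j) => //.
by exists A => //; rewrite setTI.
Qed.

HB.instance Definition _ (P : pred I) :=
  isMeasurableFun.Build _ _ (prod_space T) (sub_space P) (@restrict_sub P)
    (@measurable_restrict_sub P).

Definition glue_sub (P : pred I) (y : sub_space P) (z : sub_space (predC P)) :
    prod_space T :=
  fun j => match @boolP (P j) with
           | AltTrue Pj => y (exist _ j Pj)
           | AltFalse nPj => z (exist _ j nPj)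
           end.

End restriction.

Section data_space.
Context (R : realType) (d1 d2 : nat) (S : 'I_d2 -> pointedType).

(* A coordinate is a copy of [R] with its Borel sets, or one of the [S l] with
   all its subsets; all coordinates carry the same display so as to form one
   family of measurable types. A [measurableType] is pointed, so the [S l] are;
   this loses nothing, since an empty [S l] would leave no probability on the
   data space. *)
Definition coord_sum (s : 'I_d1 + 'I_d2) : Type :=
  match s with inl _ => R | inr l => S l end.

Definition coord_sum_measurable (s : 'I_d1 + 'I_d2) : set (set (coord_sum s)) :=
  match s with inl _ => @measurable _ R | inr _ => setT end.

Definition coord_sum_point (s : 'I_d1 + 'I_d2) : coord_sum s :=
  match s with inl _ => 0%R | inr _ => point end.

Definition coord_sort (j : 'I_(d1 + d2)) : Type := coord_sum (fintype.split j).

Definition coord_display : measure_display.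
Proof. exact default_measure_display. Qed.

Section coord_instance.
Variable j : 'I_(d1 + d2).

Definition coord_measurable : set (set (coord_sort j)) :=
  @coord_sum_measurable (fintype.split j).

Let coord_measurable0 : coord_measurable set0.
Proof.
by rewrite /coord_measurable /coord_sort; case: (fintype.split j) => [i|l] //=.
Qed.

Let coord_measurableC A : coord_measurable A -> coord_measurable (~` A).
Proof.
move: A; rewrite /coord_measurable /coord_sort; case: (fintype.split j) => [i|l] //= A.
exact: measurableC.
Qed.

Let coord_measurable_bigcup (F : (set (coord_sort j))^nat) :
  (forall i, coord_measurable (F i)) -> coord_measurable (\bigcup_i F i).
Proof.
move: F; rewrite /coord_measurable /coord_sort.
by case: (fintype.split j) => [i|l] //= F mF; exact: bigcupT_measurable.
Qed.

HB.instance Definition _ := gen_eqMixin (coord_sort j).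
HB.instance Definition _ := gen_choiceMixin (coord_sort j).
HB.instance Definition _ :=
  isPointed.Build (coord_sort j) (@coord_sum_point (fintype.split j)).
HB.instance Definition _ := @isMeasurable.Build coord_display (coord_sort j)
  coord_measurable coord_measurable0 coord_measurableC coord_measurable_bigcup.

End coord_instance.

Definition coord (j : 'I_(d1 + d2)) : measurableType coord_display :=
  Measurable.clone coord_display (coord_sort j) _.

Definition data_space : measurableType (prod_space_display coord_display) :=
  Measurable.clone _ (prod_space coord) _.

End data_space.
Arguments data_space R d1 {d2} S.

Section KL.
Context (d : measure_display) (T : measurableType d) (R : realType).

Definition KL (q p : probability T R) : \bar R :=
  if `[< q `<< p >]
  then \int[q]_x lne ('d (charge_of_finite_measure q) '/d p x)
  else +oo.

End KL.

(* [m j = true] means that the coordinate [j] is observed. *)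
Definition obs_mask (D : nat) : finType := {ffun 'I_D -> bool}.

Section masked_distributions.
Context (R : realType) (d1 d2 : nat) (S : 'I_d2 -> pointedType).
Local Notation X := (data_space R d1 S).
Local Notation masks := (obs_mask (d1 + d2)).

Definition observed (m : masks) := sub_space (@coord R d1 d2 S) m.

Definition missing (m : masks) := sub_space (@coord R d1 d2 S) (predC m).

Definition obs (m : masks) : {mfun X >-> observed m} :=
  @restrict_sub _ _ (@coord R d1 d2 S) m.

Definition mis (m : masks) : {mfun X >-> missing m} :=
  @restrict_sub _ _ (@coord R d1 d2 S) (predC m).

Definition marginal (p : probability X R) (m : masks) :
    probability (observed m) R :=
  distribution p (obs m).

Definition is_cond_law (p : probability X R) (m : masks)
    (k : R.-pker (observed m) ~> (missing m)) : Prop :=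
  forall (A : set (observed m)) (B : set (missing m)),
    measurable A -> measurable B ->
    p (obs m @^-1` A `&` mis m @^-1` B) =
    \int[marginal p m]_(y in A) k y B.

(* A measure is a function on all subsets, with unspecified values on the
   non-measurable ones: equality of laws is equality on measurable sets. *)
Definition compatible (M : {set masks}) (pstar : probability X R) :
    set (probability X R) :=
  [set q | forall m, m \in M -> forall A : set (observed m), measurable A ->
     marginal q m A = marginal pstar m A].

(* The conditional laws of [p] are determined only up to [p]-null sets, so the
   update is a relation: [p'] is the mixture obtained from some version of the
   conditional laws of [p]. *)
Definition is_update (M : {set masks}) (mu : masks -> R)
    (pstar p p' : probability X R) : Prop :=
  exists k : forall m : masks, R.-pker (observed m) ~> (missing m),
    (forall m, m \in M -> is_cond_law p (k m)) /\
    forall A : set X, measurable A ->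
      p' A = \sum_(m in M) (mu m)%:E *
        \int[marginal pstar m]_y k m y (glue_sub y @^-1` A).

End masked_distributions.

(* Main.v *)
Require Import Defs.
From HB Require Import structures.
From mathcomp Require Import all_boot all_order all_algebra.
From mathcomp Require Import all_classical all_reals all_analysis.
From mathcomp Require Import measurable_realfun lra.

(* Let [r] be compatible with [pstar] and [KL r (p 0) < +oo]. If [g m] is the
   density of [marginal pstar m] with respect to [marginal (p n) m], then
   [h := \sum_m mu m * g m (obs m x)] is the density of [p n.+1] with respect to
   [p n], so that [r]-almost everywhere, by concavity of the logarithm,
     ln (dr/dp_n) = ln (dr/dp_{n+1}) + ln h
                 >= ln (dr/dp_{n+1}) + \sum_m mu m * ln (g m (obs m x)).
   Integrating against [r], whose marginals are those of [pstar],
     KL r (p n.+1) + \sum_m mu m * KL (marginal pstar m) (marginal (p n) m)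
       <= KL r (p n).
   The sequence [KL r (p n)] is thus nonincreasing and nonnegative, hence
   convergent, and its increments bound the divergences of the marginals. *)

Set Implicit Arguments.
Unset Strict Implicit.
Unset Printing Implicit Defensive.
Import Order.TTheory GRing.Theory Num.Theory.
Import numFieldNormedType.Exports.

Local Open Scope classical_set_scope.
Local Open Scope ring_scope.
Local Open Scope ereal_scope.

(** * Densities of finite measures *)

Section density.
Context (d : measure_display) (T : measurableType d) (R : realType).
Implicit Types (q p : {finite_measure set T -> \bar R}) (f g : T -> R).

(** A real-valued, everywhere nonnegative version of the Radon-Nikodym derivative: sums, products
    and logarithms of densities are then taken in [R], free of infinite values. *)
Definition is_density q p f : Prop :=
  [/\ measurable_fun setT f, forall x, (0 <= f x)%R &
      forall A, measurable A -> q A = \int[p]_(x in A) (f x)%:E].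

Lemma density_exists q p : q `<< p -> exists f, is_density q p f.
Proof.
move=> qp; pose F := Radon_Nikodym_SigmaFinite.f q p.
have FE x : F x = (fine (F x))%:E.
  by rewrite fineK//; exact: Radon_Nikodym_SigmaFinite.f_fin_num.
have mF : measurable_fun [set: T] F.
  exact: measurable_int (Radon_Nikodym_SigmaFinite.f_integrable qp).
exists (fine \o F); split.
- exact: measurableT_comp.
- by move=> x /=; rewrite fine_ge0//; exact: Radon_Nikodym_SigmaFinite.f_ge0.
- move=> A mA; rewrite (Radon_Nikodym_SigmaFinite.f_integral qp mA).
  by apply: eq_integral => x _; exact: FE.
Qed.

Lemma density_dominates q p f : is_density q p f -> q `<< p.
Proof.
case=> mf f0 qE; apply/null_content_dominatesP => A mA pA0.
rewrite qE// null_set_integral//; exact/measurable_funTS/measurable_EFinP.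
Qed.

Lemma density_integrable q p f : is_density q p f ->
  p.-integrable setT (EFin \o f).
Proof.
case=> mf f0 qE; apply/integrableP; split; first exact/measurable_EFinP.
under eq_integral do rewrite /= ger0_norm//.
by rewrite -qE// -ge0_fin_numE// fin_num_measure.
Qed.

Lemma density_ae_unique q p f g : is_density q p f -> is_density q p g ->
  {ae p, forall x, f x = g x}.
Proof.
move=> qf qg; have [mg _ gE] := qg; have [mf _ fE] := qf.
have : ae_eq p setT (EFin \o f) (EFin \o g).
  apply: integral_ae_eq => //.
  - exact: density_integrable qf.
  - exact/measurable_EFinP.
  - by move=> E _ mE; rewrite -fE// -gE.
by apply: filterS => x /(_ Logic.I)[].
Qed.

(** The change of variables known for the canonical Radon-Nikodym derivative transfers to [f]: the
    two have the same integral over every measurable set, hence agree [p]-almost everywhere. *)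
Lemma ge0_integral_density q p f (h : T -> \bar R) A : is_density q p f ->
  measurable A -> (forall x, 0 <= h x) -> measurable_fun A h ->
  \int[q]_(x in A) h x = \int[p]_(x in A) (h x * (f x)%:E).
Proof.
move=> qf mA h0 mh; have qp := density_dominates qf.
rewrite -(Radon_Nikodym_SigmaFinite.change_of_variables qp h0 mA mh).
have [mf f0 fE] := qf; pose F := Radon_Nikodym_SigmaFinite.f q p.
have iF := Radon_Nikodym_SigmaFinite.f_integrable qp.
have mF : measurable_fun [set: T] F by exact: measurable_int iF.
have Ff : ae_eq p setT F (EFin \o f).
  apply: integral_ae_eq => //; first exact/measurable_EFinP.
  by move=> E _ mE; rewrite -fE// -Radon_Nikodym_SigmaFinite.f_integral.
apply: ae_eq_integral => //.
- by apply: emeasurable_funM => //; exact: measurable_funTS.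
- by apply: emeasurable_funM => //; exact/measurable_funTS/measurable_EFinP.
- by apply: filterS Ff => x /(_ Logic.I) /= <-.
Qed.

(** The [q]-mass of the zero set of [f] is the integral of [f] over it, which is 0. This makes
    logarithms of densities usable under [q]. *)
Lemma density_gt0 q p f : is_density q p f -> {ae q, forall x, (0 < f x)%R}.
Proof.
case=> mf f0 fE; exists (f @^-1` [set 0%R]); split.
- by rewrite -[X in measurable X]setTI; exact: mf.
- rewrite fE; last by rewrite -[X in measurable X]setTI; exact: mf.
  by rewrite integral0_eq// => x /= ->.
- by move=> x /= /negP; rewrite -leNgt => fx0; apply/eqP; rewrite eq_le fx0 f0.
Qed.

End density.

(** * Kullback-Leibler divergence through log-densities *)

Section KL_density.
Local Open Scope charge_scope.
Context (d : measure_display) (T : measurableType d) (R : realType).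
Implicit Types (q p : probability T R) (f : T -> R).

(** The real logarithm is 0 at 0, where [lne] is [-oo]; if [f] is a density of [q], the two differ
    only on a [q]-null set. *)
Definition lnf f x : \bar R := (ln (f x))%:E.

Lemma measurable_lnf f : measurable_fun [set: T] f ->
  measurable_fun [set: T] (lnf f).
Proof.
by move=> mf; apply/measurable_EFinP; exact: measurableT_comp (@measurable_ln R) mf.
Qed.

Lemma measurable_expRN_ln f : measurable_fun [set: T] f ->
  measurable_fun [set: T] (fun x => (expR (- ln (f x)))%:E).
Proof.
move=> mf; apply/measurable_EFinP; apply: measurableT_comp => //.
by apply: measurableT_comp => //; exact: measurableT_comp (@measurable_ln R) mf.
Qed.

(** The derivative chosen in [KL] equals [f] [p]-almost everywhere, hence [q]-almost everywhere by
    domination; [f] is positive there, so that [lne] reduces to [ln]. *)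
Lemma KL_density q p f : is_density q p f -> KL q p = \int[q]_x lnf f x.
Proof.
move=> qf; have qp := density_dominates qf; have [mf f0 fE] := qf.
rewrite /KL asboolT//; set F := 'd _ '/d p.
have F_fin x : F x = (fine (F x))%:E.
  by rewrite fineK//; exact: Radon_Nikodym_fin_num.
have iF : p.-integrable [set: T] F by exact: Radon_Nikodym_integrable.
have mF : measurable_fun [set: T] F by exact: measurable_int iF.
have Ff : ae_eq p setT F (EFin \o f).
  apply: integral_ae_eq => //; first exact/measurable_EFinP.
  by move=> E _ mE; rewrite -fE// -Radon_Nikodym_integral.
apply: ae_eq_integral => //; last 2 first.
- exact: measurable_lnf.
- have {}Ff := null_dominates_ae_eq measurableT qp Ff.
  apply: filterS2 Ff (density_gt0 qf) => x /(_ Logic.I) Ffx fx0 _.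
  by rewrite Ffx /= leNgt fx0.
(* Unfolding [lne] at a finite value into a case distinction on the sign shows the integrand to be
   measurable. *)
rewrite (_ : (fun x => _) = (fun x => if (fine (F x) <= 0)%R then -oo
    else lnf (fine \o F) x)).
  have mfF : measurable_fun [set: T] (fine \o F) by exact: measurableT_comp.
  apply: measurable_fun_ifT => //; last exact: measurable_lnf.
  by apply: measurable_fun_ler => //; exact: measurable_cst.
by apply/funext => x; rewrite F_fin.
Qed.

(* Where [f] vanishes [ln (f x) = 0], so that the integrand is [1] rather than
   [+oo]; this [q]-null set is harmless. *)
Lemma integral_expRN_ln_le1 q p f : is_density q p f ->
  \int[q]_x (expR (- ln (f x)))%:E <= 1.
Proof.
move=> qf; have [mf f0 fE] := qf.
have mE := measurable_expRN_ln mf.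
rewrite (ge0_integral_density qf)//.
apply: (@le_trans _ _ (\int[p]_x cst 1 x)); last first.
  by rewrite integral_cst// mul1e; exact: probability_le1.
apply: ge0_le_integral => //.
- by move=> x _; rewrite mule_ge0// lee_fin ?expR_ge0.
- by apply: emeasurable_funM => //; exact/measurable_EFinP.
- move=> x _; rewrite -EFinM lee_fin.
  have := f0 x; rewrite le_eqVlt => /predU1P[<-|fx0]; first by rewrite mulr0.
  by rewrite expRN lnK ?posrE// mulVf// gt_eqF.
Qed.

(** The negative part of [ln t] is at most [expR (- ln t)], whose [q]-integral is at most 1. This
    covers the case of an infinite divergence. *)
Lemma integrable_lnf_neg q p f : is_density q p f ->
  q.-integrable [set: T] (lnf f)^\-.
Proof.
move=> qf; have [mf f0 fE] := qf.
have mE := measurable_expRN_ln mf.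
apply/integrableP; split; first exact/measurable_funeneg/measurable_lnf.
apply: (@le_lt_trans _ _ (\int[q]_x (expR (- ln (f x)))%:E)); last first.
  exact: le_lt_trans (integral_expRN_ln_le1 qf) (ltry _).
apply: ge0_le_integral => //.
- by apply: measurableT_comp => //; exact/measurable_funeneg/measurable_lnf.
- move=> x _; rewrite gee0_abs// funenegE ge_max !lee_fin expR_ge0 andbT.
  by rewrite (le_trans _ (expR_ge1Dx _))// lerDr.
Qed.

Lemma KL_ge0 q p : 0 <= KL q p.
Proof.
have [qp|nqp] := pselect (q `<< p); last by rewrite /KL asboolF// leey.
have [f qf] := density_exists qp; have [mf f0 fE] := qf.
have nfin := integrable_fin_num measurableT (integrable_lnf_neg qf).
rewrite (KL_density qf) integralE sube_ge0 ?nfin ?orbT//.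
have mE := measurable_expRN_ln mf.
have mn := measurable_funeneg (measurable_lnf mf).
have mp := measurable_funepos (measurable_lnf mf).
(* In the form [1 + (ln f)^- <= 1/f + (ln f)^+] both sides of the pointwise inequality are
   nonnegative, so that they can be integrated even if the positive part has infinite integral. *)
rewrite -(@leeD2lE _ 1)//.
apply: (@le_trans _ _ (\int[q]_x (1 + (lnf f)^\- x))).
  rewrite ge0_integralD//.
  rewrite integral_cst// mul1e leeD2r//.
  by have := @probability_setT _ _ _ q; move=> /= ->.
apply: (@le_trans _ _ (\int[q]_x ((expR (- ln (f x)))%:E + (lnf f)^\+ x))).
  apply: ge0_le_integral => //.
  - by move=> x _; rewrite adde_ge0.
  - by apply: emeasurable_funD => //; exact: measurable_cst.
  - by apply: emeasurable_funD.
  - move=> x _; rewrite funeposE funenegE /lnf -EFinN -!EFin_max -!EFinD lee_fin.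
    (* 1 - 1/t <= ln t *)
    have := expR_ge1Dx (- ln (f x)).
    by case: (ler0P (ln (f x))) => ?; case: (ler0P (- ln (f x))) => ?; lra.
rewrite ge0_integralD//.
exact/leeD2r/integral_expRN_ln_le1/qf.
Qed.

(** Since the negative part always has a finite integral, a finite divergence bounds the integral of
    the positive part. *)
Lemma integrable_lnf q p f : is_density q p f -> KL q p < +oo ->
  q.-integrable [set: T] (lnf f).
Proof.
move=> qf; have [mf f0 fE] := qf.
rewrite (KL_density qf) integralE => h.
have iN := integrable_lnf_neg qf.
rewrite (funeposneg (lnf f)); apply: integrableB => //.
apply/integrableP; split; first exact/measurable_funepos/measurable_lnf.
under eq_integral do rewrite gee0_abs//.
move: h; have := integrable_fin_num measurableT iN.
case: (\int[q]_x (lnf f)^\- x) => // r _.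
by rewrite lteBlDr// addye.
Qed.

End KL_density.

(** * Jensen's inequality for the logarithm of a finite convex combination *)

Lemma convex_sum_gt0 (R : realType) (I : finType) (M : {set I}) (w a : I -> R) :
  (forall i, i \in M -> 0 < w i)%R -> (\sum_(i in M) w i = 1)%R ->
  (forall i, i \in M -> 0 < a i)%R -> (0 < \sum_(i in M) w i * a i)%R.
Proof.
move=> w0 w1 a0; have [i iM] : exists i, i \in M.
  apply/set0Pn; apply: contra_eq_neq w1 => ->.
  by rewrite big_set0 eq_sym oner_neq0.
rewrite (bigD1 i)//= ltr_pwDl ?mulr_gt0 ?w0 ?a0// sumr_ge0// => j /andP[jM _].
by rewrite mulr_ge0// ltW ?w0 ?a0.
Qed.

(** The bound [ln t <= t - 1] is applied at [t = a i / s], with [s] the convex combination; the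
    [w]-weighted sum of the right-hand sides is [1 - 1 = 0]. *)
Lemma ln_concave_sum (R : realType) (I : finType) (M : {set I}) (w a : I -> R) :
  (forall i, i \in M -> 0 < w i)%R -> (\sum_(i in M) w i = 1)%R ->
  (forall i, i \in M -> 0 < a i)%R ->
  (\sum_(i in M) w i * ln (a i) <= ln (\sum_(i in M) w i * a i))%R.
Proof.
move=> w0 w1 a0; have s0 := convex_sum_gt0 w0 w1 a0.
set s := (\sum_(i in M) w i * a i)%R in s0 *.
rewrite -subr_le0 -[X in (_ - X)%R]mul1r -w1 mulr_suml -sumrB.
apply: (@le_trans _ _ (\sum_(i in M) (w i * a i / s - w i))%R).
  apply: ler_sum => i iM; rewrite -mulrBr -ln_div ?posrE ?a0//.
  rewrite -mulrA -[X in (_ - X)%R]mulr1 -mulrBr ler_pM2l ?w0//.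
  have /le_ln1Dx : (-1 < a i / s - 1)%R by rewrite ltrBrDl subrr divr_gt0// a0.
  by rewrite addrC subrK.
by rewrite sumrB w1 -mulr_suml divff ?subrr// gt_eqF.
Qed.

(** * Integration of inequalities that hold almost everywhere *)

Section ae_integral.
Context (d : measure_display) (T : measurableType d) (R : realType).
Context (mu : {measure set T -> \bar R}).
Implicit Types f g : T -> \bar R.

Lemma ae_le_integrable f g : measurable_fun [set: T] f ->
  {ae mu, forall x, `|f x| <= g x} -> mu.-integrable [set: T] g ->
  mu.-integrable [set: T] f.
Proof.
move=> mf fg /integrableP[mg ig]; apply/integrableP; split => //.
apply: le_lt_trans ig; apply: ae_ge0_le_integral => //.
- exact: measurableT_comp.
- exact: measurableT_comp.
- by apply: filterS fg => x fgx _; rewrite (le_trans fgx)// lee_abs.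
Qed.

Lemma ae_le_integral f g : mu.-integrable [set: T] f ->
  mu.-integrable [set: T] g -> {ae mu, forall x, f x <= g x} ->
  \int[mu]_x f x <= \int[mu]_x g x.
Proof.
move=> if_ ig fg.
have iB : mu.-integrable [set: T] (g \- f) by exact: integrableB.
have mB : measurable_fun [set: T] (g \- f) by exact: measurable_int iB.
rewrite -sube_ge0; last by rewrite (integrable_fin_num _ if_)// orbT.
rewrite -integralB// (@ae_eq_integral _ _ _ _ _ (fun x => `|(g \- f) x|))//.
- exact: integral_ge0.
- exact: measurableT_comp.
- apply: filterS2 fg (integrable_ae measurableT if_) => x fgx ffin _ /=.
  by rewrite gee0_abs// sube_ge0// ffin ?orbT.
Qed.

End ae_integral.

Section integral_sum_le.
Context (d : measure_display) (T : measurableType d) (R : realType).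
Context (q : {measure set T -> \bar R}) (I : finType) (M : {set I}).
Variables (w : I -> R) (u v0 : T -> R) (v : I -> T -> R).
Local Notation integrable f := (q.-integrable [set: T] (EFin \o f)).
Local Notation integrable_neg f :=
  (measurable_fun [set: T] f /\ q.-integrable [set: T] (EFin \o f)^\-).

(** Each term on the left is bounded below by its own negative part, and above by [u] plus the
    negative parts of the other terms. Integrability of [u] thus passes to every term, after which
    the inequality can be integrated termwise. *)
Lemma integrable_sum_le : (forall i, i \in M -> 0 < w i)%R ->
  integrable u -> integrable_neg v0 ->
  (forall i, i \in M -> integrable_neg (v i)) ->
  {ae q, forall x, (v0 x + \sum_(i in M) w i * v i x <= u x)%R} ->
  [/\ integrable v0, (forall i, i \in M -> integrable (v i)) &
    \int[q]_x (v0 x)%:E + \sum_(i in M) (w i)%:E * \int[q]_x (v i x)%:E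
    <= \int[q]_x (u x)%:E].
Proof.
move=> w0 iu [mv0 nv0] mnv le_u.
pose n f (x : T) : R := Num.max (- f x)%R 0%R.
have nE f : (EFin \o f)^\- = EFin \o n f.
  by apply/funext => x; rewrite funenegE /= /n EFin_max.
have n0 f x : (0 <= n f x)%R by rewrite le_max lexx orbT.
have nN f x : (- f x <= n f x)%R by rewrite le_max lexx.
(* A common integrable bound for [v0] and all the [w i * v i] in absolute value. *)
pose N x := (`|u x| + n v0 x + \sum_(i in M) w i * n (v i) x)%R.
have iN : integrable N.
  rewrite (_ : EFin \o N = (fun x => (`|(EFin \o u) x| + (EFin \o v0)^\- x) +
      \sum_(i in M) (w i)%:E * (EFin \o v i)^\- x)).
    apply: integrableD => //.
      by apply: integrableD => //; exact: integrable_abse.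
    by apply: integrable_sum => // i /mnv[_ iv]; exact: integrableZl.
  apply/funext => x; rewrite /= /N !EFinD nE /=; congr (_ + _).
  by rewrite -sumEFin; apply: eq_bigr => i _; rewrite nE.
have sum_n x : (0 <= \sum_(i in M) w i * n (v i) x)%R.
  by apply: sumr_ge0 => i iM; rewrite mulr_ge0// ltW// w0.
have sum_ge x : (- (\sum_(i in M) w i * v i x) <= \sum_(i in M) w i * n (v i) x)%R.
  rewrite -sumrN; apply: ler_sum => i iM.
  by rewrite -mulrN ler_wpM2l// ltW// w0.
have u_abs x : (u x <= `|u x|)%R by exact: ler_norm.
have iv0 : integrable v0.
  apply: ae_le_integrable iN; first exact/measurable_EFinP.
  apply: filterS le_u => x h; rewrite /= lee_fin ler_norml /N.
  have := nN v0 x; have := n0 v0 x; have := sum_n x; have := sum_ge x.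
  have := u_abs x; have := normr_ge0 (u x).
  by move: h; lra.
have iv i : i \in M -> integrable (v i).
  move=> iM; have [mvi _] := mnv _ iM; have wi := w0 _ iM.
  have iN' : integrable (fun x => (w i)^-1 * N x)%R.
    rewrite (_ : EFin \o _ = (fun x => (w i)^-1%:E * (EFin \o N) x))//.
    exact: integrableZl.
  apply: ae_le_integrable iN'; first exact/measurable_EFinP.
  apply: filterS le_u => x h; rewrite /= lee_fin ler_pdivlMl// /N.
  rewrite -[X in (X * _)%R](gtr0_norm wi) -normrM ler_norml.
  have := nN v0 x; have := n0 v0 x; have := u_abs x; have := normr_ge0 (u x).
  move: h; rewrite !(bigD1 i iM)/=.
  have := ler_wpM2l (ltW wi) (nN (v i) x); have := mulr_ge0 (ltW wi) (n0 (v i) x).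
  have : (- (\sum_(j in M | j != i) w j * v j x) <=
          \sum_(j in M | j != i) w j * n (v j) x)%R.
    rewrite -sumrN; apply: ler_sum => j /andP[jM _].
    by rewrite -mulrN ler_wpM2l// ltW// w0.
  have : (0 <= \sum_(j in M | j != i) w j * n (v j) x)%R.
    by apply: sumr_ge0 => j /andP[jM _]; rewrite mulr_ge0// ltW// w0.
  rewrite mulrN; set A := (\sum_(_ | _) _)%R; set B := (\sum_(_ | _) _)%R.
  by move: (w i * v i x)%R (w i * n (v i) x)%R => a b; lra.
split=> //.
(* Extension by 0 outside [M] makes every summand integrable, so that sum and integral are exchanged
   over all of [I]. *)
pose g i x := if i \in M then (w i * v i x)%:E else 0.
have ig i : q.-integrable [set: T] (g i).
  rewrite /g; case iM : (i \in M); last exact: integrable0.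
  rewrite (_ : (fun x => _) = (fun x => (w i)%:E * (EFin \o v i) x))//.
  by apply: integrableZl => //; exact: iv.
have sE : \sum_(i in M) (w i)%:E * \int[q]_x (v i x)%:E =
    \int[q]_x (\sum_i g i x).
  rewrite (integral_sum _ _ (index_enum I) xpredT)// big_mkcond/=.
  apply: eq_bigr => i _.
  rewrite /g; case iM : (i \in M); last by rewrite integral0.
  by under [RHS]eq_integral do rewrite EFinM; rewrite integralZl//; exact: iv.
have isum : q.-integrable [set: T] (fun x => \sum_i g i x).
  exact: integrable_sum.
rewrite sE -integralD//; apply: ae_le_integral => //; first exact: integrableD.
apply: filterS le_u => x; rewrite -lee_fin EFinD -sumEFin.
by rewrite big_mkcond.
Qed.

End integral_sum_le.

(** * Disintegration of a law along a pair of maps *)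

Section finite_image.
Context d d' (T : measurableType d) (T' : measurableType d') (R : realType).
Variables (m : {finite_measure set T -> \bar R}) (f : {mfun T >-> T'}).

(** The restriction of a probability to a set is only a finite measure; its image needs this
    structure to be treated by densities. *)
Definition finite_image : set T' -> \bar R := pushforward m f.

Let finite_image0 : finite_image set0 = 0.
Proof. exact: measure0. Qed.

Let finite_image_ge0 A : 0 <= finite_image A.
Proof. exact: measure_ge0. Qed.

Let finite_image_sigma_additive : semi_sigma_additive finite_image.
Proof. exact: measure_semi_sigma_additive. Qed.

HB.instance Definition _ := isMeasure.Build _ _ _ finite_image
  finite_image0 finite_image_ge0 finite_image_sigma_additive.

Let finite_image_fin : fin_num_fun finite_image.
Proof.
by move=> A mA; apply: fin_num_measure; rewrite -[X in measurable X]setTI;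
  exact: measurable_funP.
Qed.

HB.instance Definition _ :=
  Measure_isFinite.Build _ _ _ finite_image finite_image_fin.

End finite_image.

Section kernel_mixture.
Context d1 d2 (T1 : measurableType d1) (T2 : measurableType d2) (R : realType).
Variables (nu : {measure set T1 -> \bar R}) (k : R.-pker T1 ~> T2).

Lemma measurable_kernel_xsection A : measurable A ->
  measurable_fun [set: T1] (fun y => k y (xsection A y)).
Proof. by move=> mA; apply: measurable_fun_xsection_finite_kernel; rewrite inE. Qed.

(** For a probability [nu], the joint law of a pair with first component drawn from [nu] and second
    drawn from [k] at the first. *)
Definition kernel_mixture (A : set (T1 * T2)) : \bar R :=
  \int[nu]_y k y (xsection A y).

Let kernel_mixture0 : kernel_mixture set0 = 0.
Proof. by apply: integral0_eq => y _; rewrite xsection0 measure0. Qed.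

Let kernel_mixture_ge0 A : 0 <= kernel_mixture A.
Proof. exact: integral_ge0. Qed.

Let kernel_mixture_sigma_additive : semi_sigma_additive kernel_mixture.
Proof.
move=> F mF tF mUF; rewrite [X in _ --> X](_ : _ =
    \int[nu]_y (\sum_(n <oo) k y (xsection (F n) y))); last first.
  apply: eq_integral => y _; rewrite xsection_bigcup.
  apply/esym/cvg_lim => //; apply: measure_semi_sigma_additive.
  - by move=> n; exact: measurable_xsection.
  - exact: trivIset_xsection.
  - by apply: bigcupT_measurable => n; exact: measurable_xsection.
apply/cvg_closeP; split.
  by apply: is_cvg_nneseries => n _ _; exact: integral_ge0.
by rewrite closeE// integral_nneseries// => n; exact: measurable_kernel_xsection.
Qed.

HB.instance Definition _ := isMeasure.Build _ _ _
  kernel_mixture kernel_mixture0 kernel_mixture_ge0 kernel_mixture_sigma_additive.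

End kernel_mixture.

Section disintegration.
Context d d1 d2 (T : measurableType d) (T1 : measurableType d1)
  (T2 : measurableType d2) (R : realType).
Variables (f1 : {mfun T >-> T1}) (f2 : {mfun T >-> T2}) (glue : T1 * T2 -> T).
Hypotheses (mglue : measurable_fun [set: T1 * T2] glue)
  (glueK : forall x, glue (f1 x, f2 x) = x)
  (f1_glue : forall yz, f1 (glue yz) = yz.1).
Variables (P : probability T R) (k : R.-pker T1 ~> T2).
Hypothesis Pk : forall A B, measurable A -> measurable B ->
  P (f1 @^-1` A `&` f2 @^-1` B) = \int[distribution P f1]_(y in A) k y B.

Let f12 x := (f1 x, f2 x).

Let measurable_f12 : measurable_fun [set: T] f12.
Proof. by apply: measurable_fun_pair; exact: measurable_funP. Qed.

HB.instance Definition _ := isMeasurableFun.Build _ _ _ _ f12 measurable_f12.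

Let measurable_glue_preimage A : measurable A -> measurable (glue @^-1` A).
Proof. by move=> mA; rewrite -[X in measurable X]setTI; exact: mglue. Qed.

(** On rectangles the identity is [Pk]. Rectangles are stable under intersection and generate the
    product sigma-algebra, so the two measures agree everywhere; [glue] carries the result back to
    [T]. *)
Lemma disintegration A : measurable A ->
  P A = \int[distribution P f1]_y k y (xsection (glue @^-1` A) y).
Proof.
move=> mA; pose G : set (set (T1 * T2)) :=
  [set A `*` B | A in measurable & B in measurable].
have -> : P A = distribution P f12 (glue @^-1` A).
  rewrite /distribution /pushforward; congr (P _).
  by apply/seteqP; split => x /=; rewrite glueK.
apply: (@measure_unique _ R _ G (fun=> setT) _ _ _ _ (distribution P f12)
  (kernel_mixture (distribution P f1) k)).
- by rewrite measurable_prod_measurableType.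
- move=> _ _ [A1 mA1 [A2 mA2 <-]] [B1 mB1 [B2 mB2 <-]].
  exists (A1 `&` B1); first exact: measurableI.
  exists (A2 `&` B2); first exact: measurableI.
  by rewrite setXI.
- by move=> _; exists setT => //; exists setT => //; rewrite setXTT.
- by rewrite bigcup_const//; exists 0%N.
- move=> _ [B mB [C mC <-]]; rewrite /kernel_mixture.
  rewrite [LHS](_ : _ = P (f1 @^-1` B `&` f2 @^-1` C))// Pk//.
  rewrite integral_mkcond; apply: eq_integral => y _; rewrite patchE.
  case: ifPn => yB; first by rewrite in_xsectionX.
  by rewrite notin_xsectionX// measure0.
- by move=> n; rewrite -ge0_fin_numE//; exact: fin_num_measure.
- exact: measurable_glue_preimage.
Qed.

(** One term of the update: replacing the law of [f1] by [Q] while keeping the conditional kernel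
    amounts to reweighting [P] by [g \o f1]. *)
Lemma integral_density_disintegration (Q : probability T1 R) (g : T1 -> R) A :
  is_density Q (distribution P f1) g -> measurable A ->
  \int[Q]_y k y (xsection (glue @^-1` A) y) = \int[P]_(x in A) (g (f1 x))%:E.
Proof.
move=> Qg mA; have [mg g0 gE] := Qg.
have mgA := measurable_glue_preimage mA.
pose kA y := fine (k y (xsection (glue @^-1` A) y)).
have kAE y : k y (xsection (glue @^-1` A) y) = (kA y)%:E.
  rewrite fineK// ge0_fin_numE// (le_lt_trans _ (ltry 1))//.
  have -> : 1 = k y setT by rewrite prob_kernel.
  by apply: le_measure; rewrite ?inE//; exact: measurable_xsection.
have mk := measurable_kernel_xsection k mgA.
have mkA : measurable_fun [set: T1] kA by exact: measurableT_comp mk.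
have kA0 y : (0 <= kA y)%R by rewrite fine_ge0.
have mE : measurable_fun [set: T1] (EFin \o g) by exact/measurable_EFinP.
rewrite (ge0_integral_density Qg)//.
(* Both sides are the integral of [g] against [P (A `&` f1 @^-1` _)], of which
   [kA] is the density with respect to the law of [f1]. *)
transitivity (\int[finite_image (mrestr P mA) f1]_y (g y)%:E).
  rewrite (@ge0_integral_density _ _ _ (finite_image (mrestr P mA) f1)
    (distribution P f1) kA)//.
  - by apply: eq_integral => y _; rewrite muleC kAE.
  - split=> // B mB; rewrite [LHS](_ : _ = P (A `&` f1 @^-1` B)); last first.
      by rewrite /finite_image /pushforward/= /mrestr setIC.
    rewrite disintegration; last first.
      apply: measurableI => //; rewrite -[X in measurable X]setTI.
      exact: measurable_funP.
    rewrite [RHS]integral_mkcond; apply: eq_integral => y _; rewrite patchE.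
    rewrite preimage_setI xsectionI; case: ifPn => yB.
      rewrite -kAE; congr (k y _); rewrite setIidl// => z _.
      by apply/xsectionP; rewrite /= f1_glue /=; rewrite inE in yB.
    rewrite [X in k y X](_ : _ = set0) ?measure0//.
    apply/seteqP; split => // z [_ /xsectionP/=].
    by rewrite f1_glue /=; rewrite notin_setE in yB.
rewrite ge0_integral_pushforward//; last by move=> y _; rewrite lee_fin.
rewrite preimage_setT.
have mgf : measurable_fun [set: T] (EFin \o (g \o f1)).
  by apply/measurable_EFinP; exact: measurableT_comp.
(* The restriction of [P] to [A] has density [\1_A], which turns the integral into one over [A]. *)
rewrite (@ge0_integral_density _ _ _ (mrestr P mA) P (\1_A))//.
- rewrite [RHS]integral_mkcond; apply: eq_integral => x _.
  by rewrite patchE indicE /=; case: ifPn => _; rewrite ?mule1 ?mule0.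
- split=> [|x|B mB]; first exact: measurable_indic.
    by rewrite indicE ler0n.
  by rewrite integral_indic// /mrestr setIC.
- by move=> x; rewrite lee_fin.
Qed.

End disintegration.

(** * Decrease of the divergence in one step, for abstract observation maps *)

Lemma null_dominates_ae d (T : measurableType d) (R : realType)
    (q p : {measure set T -> \bar R}) (S : T -> Prop) :
  q `<< p -> {ae p, forall x, S x} -> {ae q, forall x, S x}.
Proof.
move=> /null_content_dominatesP qp [N [mN N0 sN]].
by exists N; split => //; exact: qp.
Qed.

Lemma KL_lty_dominates d (T : measurableType d) (R : realType)
    (q p : probability T R) : KL q p < +oo -> q `<< p.
Proof. by rewrite /KL; case: asboolP. Qed.

Lemma ae_distribution d d' (T : measurableType d) (T' : measurableType d')
    (R : realType) (P : probability T R) (f : {mfun T >-> T'}) (S : T' -> Prop) :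
  {ae distribution P f, forall y, S y} -> {ae P, forall x, S (f x)}.
Proof.
move=> [N [mN N0 sN]]; exists (f @^-1` N); split => //.
- by rewrite -[X in measurable X]setTI; exact: measurable_funP.
- by move=> x /= Sx; exact: sN.
Qed.

Lemma integrable_comp_distribution d d' (T : measurableType d)
    (T' : measurableType d') (R : realType) (P : probability T R)
    (f : {mfun T >-> T'}) (g : T' -> \bar R) :
  (distribution P f).-integrable [set: T'] g -> P.-integrable [set: T] (g \o f).
Proof.
move=> /integrableP[mg ig]; apply/integrableP; split.
  exact: measurableT_comp.
move: ig; rewrite /distribution ge0_integral_pushforward//.
exact: measurableT_comp.
Qed.

Section KL_descent.
Context (d dI : measure_display) (T : measurableType d) (R : realType).
Context (I : finType) (TI : I -> measurableType dI).
Variables (f : forall i, {mfun T >-> TI i}) (M : {set I}) (w : I -> R).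
Hypotheses (w_gt0 : forall i, i \in M -> (0 < w i)%R)
  (w_sum1 : (\sum_(i in M) w i = 1)%R).
Variables (Q : forall i, probability (TI i) R) (r P P' : probability T R).
Hypothesis rQ : forall i, i \in M -> forall A, measurable A ->
  distribution r (f i) A = Q i A.
Variable g : forall i, TI i -> R.
Arguments g : clear implicits.
Hypothesis Qg : forall i, i \in M ->
  is_density (Q i) (distribution P (f i)) (g i).
Let h x := (\sum_(i in M) w i * g i (f i x))%R.
Hypothesis P'h : is_density P' P h.

Let rg i : i \in M -> is_density (distribution r (f i)) (distribution P (f i)) (g i).
Proof.
by move=> iM; have [mg g0 gE] := Qg iM; split => // A mA; rewrite -gE//; exact: rQ.
Qed.

(** Under [r] the map [f i] has law [Q i], which gives no mass to the zero set of its density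
    [g i]. *)
Let g_gt0 : {ae r, forall x, forall i, i \in M -> (0 < g i (f i x))%R}.
Proof.
apply: filter_forall => i; case iM : (i \in M); last by apply: nearW.
by apply: filterS (ae_distribution (density_gt0 (rg iM))) => x ? _.
Qed.

Let h_gt0 : {ae r, forall x, (0 < h x)%R}.
Proof. by apply: filterS g_gt0 => x gx; exact: convex_sum_gt0. Qed.

(** If [P' A = 0], then [h] vanishes [P]-almost everywhere on [A], hence also [r]-almost everywhere;
    as [h] is positive [r]-almost everywhere, [A] is [r]-null. *)
Let r_dominated : r `<< P -> r `<< P'.
Proof.
move=> rP; apply/null_content_dominatesP => A mA P'A; have [mh h0 hE] := P'h.
have : ae_eq P A (EFin \o h) (cst 0).
  apply/ae_eq_integral_abs => //; first exact/measurable_funTS/measurable_EFinP.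
  rewrite -[RHS](etrans (esym (hE A mA)) P'A).
  by apply: eq_integral => x _; rewrite gee0_abs// lee_fin.
move=> /(null_dominates_ae rP) hA0.
apply: measure_negligible => //.
have : {ae r, forall x, ~ A x}.
  apply: filterS2 hA0 h_gt0 => x /[swap] hx /[apply] -[h0x].
  by rewrite h0x ltxx in hx.
case=> N [mN N0 sN]; exists N; split => // x Ax; apply: sN => /=.
by move=> /(_ Ax).
Qed.

Lemma KL_descent : KL r P < +oo ->
  [/\ KL r P' < +oo,
    forall i, i \in M -> KL (Q i) (distribution P (f i)) < +oo &
    KL r P' + \sum_(i in M) (w i)%:E * KL (Q i) (distribution P (f i)) <= KL r P].
Proof.
move=> KLr; have rP := KL_lty_dominates KLr; have rP' := r_dominated rP.
have [f0 f0E] := density_exists rP; have [f1 f1E] := density_exists rP'.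
have [mf0 f0_ge0 rE0] := f0E; have [mf1 f1_ge0 rE1] := f1E.
have [mh h_ge0 hE] := P'h.
(* Chain rule: the density of [r] along [P] factors through [P']. *)
have f1h : is_density r P (fun x => f1 x * h x)%R.
  split; [exact: measurable_funM|by move=> x; rewrite mulr_ge0|move=> A mA].
  rewrite rE1// (ge0_integral_density P'h)//.
  exact/measurable_funTS/measurable_EFinP.
have f01 := null_dominates_ae rP (density_ae_unique f0E f1h).
have le_ln : {ae r, forall x, (ln (f1 x) + \sum_(i in M) w i * ln (g i (f i x))
    <= ln (f0 x))%R}.
  apply: filterS3 f01 g_gt0 (density_gt0 f1E) => x -> gx f1x.
  rewrite lnM ?posrE//; last exact: convex_sum_gt0.
  by rewrite lerD2l; exact: ln_concave_sum.
have mg i : i \in M -> measurable_fun [set: TI i] (g i) by case/Qg.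
have mln (s : T -> R) : measurable_fun [set: T] s ->
    measurable_fun [set: T] (fun x => ln (s x)).
  by move=> ms; exact: measurableT_comp (@measurable_ln R) ms.
(* Only [ln f0] is known to be integrable here. The other terms are log-densities, so their negative
   parts are integrable, and finiteness of the remaining divergences is an output. *)
have [||i iM||if1 ig le_int] := @integrable_sum_le _ _ _ r _ M w
  (fun x => ln (f0 x)) (fun x => ln (f1 x)) (fun i x => ln (g i (f i x))) w_gt0.
- exact: integrable_lnf f0E KLr.
- by split; [exact: mln|exact: integrable_lnf_neg f1E].
- split; first by apply: mln; apply: measurableT_comp => //; exact: mg.
  rewrite (_ : _^\- = (lnf (g i))^\- \o f i); last by rewrite -funeneg_comp.
  exact: integrable_comp_distribution (integrable_lnf_neg (rg iM)).
- exact: le_ln.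
have KLg i : i \in M -> KL (Q i) (distribution P (f i)) =
    \int[r]_x (ln (g i (f i x)))%:E.
  move=> iM; rewrite (KL_density (Qg iM)).
  rewrite -(@eq_measure_integral _ _ _ _ _ (distribution r (f i))); last first.
    by move=> A mA _; exact: rQ.
  rewrite /distribution integral_pushforward//; last exact: ig.
  exact/measurable_lnf/mg.
split.
- by rewrite (KL_density f1E); exact: integrable_lty.
- by move=> i iM; rewrite KLg//; apply: integrable_lty => //; exact: ig.
- rewrite (KL_density f1E) (KL_density f0E); apply: le_trans le_int.
  by apply: leeD2l; apply: lee_sum => i iM; rewrite KLg.
Qed.

End KL_descent.

(** * Splitting a point into observed and missing coordinates *)

Section glue.
Context (I : Type) (d : measure_display) (T : I -> measurableType d) (P : pred I).

Lemma measurable_prod_space_proj (J : Type) (V : J -> measurableType d) (j : J) :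
  measurable_fun [set: prod_space V] (fun x => x j).
Proof.
move=> _ A mA; apply: sub_sigma_algebra; exists j => //.
by exists A => //; rewrite !setTI.
Qed.

(** Uncurried, so that the section at [y] of a preimage is the preimage under [glue_sub y] that
    occurs in the update. *)
Definition glue (yz : sub_space T P * sub_space T (predC P)) : prod_space T :=
  glue_sub yz.1 yz.2.

Lemma glue_observed yz j (Pj : P j) : glue yz j = yz.1 (exist _ j Pj).
Proof.
rewrite /glue /glue_sub.
(* Stating the claim for an arbitrary [b] and inhabitant of [alt_spec] frees the index for case
   analysis; irrelevance of boolean proofs then identifies the subtype elements. *)
suff H b (a : alt_spec (P j) (P j) b) : match a with
    | AltTrue Pj' => yz.1 (exist _ j Pj')
    | AltFalse nPj => yz.2 (exist _ j nPj) end = yz.1 (exist _ j Pj) by exact: H.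
by case: a => [Pj'|nPj]; [rewrite (bool_irrelevance Pj' Pj)|case/negP: (nPj)].
Qed.

Lemma glue_missing yz j (nPj : predC P j) : glue yz j = yz.2 (exist _ j nPj).
Proof.
rewrite /glue /glue_sub.
suff H b (a : alt_spec (P j) (P j) b) : match a with
    | AltTrue Pj => yz.1 (exist _ j Pj)
    | AltFalse nPj' => yz.2 (exist _ j nPj') end = yz.2 (exist _ j nPj) by exact: H.
case: a => [Pj|nPj']; first by have := nPj; rewrite /= Pj.
by rewrite (bool_irrelevance nPj' nPj).
Qed.

Lemma measurable_glue : measurable_fun setT glue.
Proof.
apply: (@measurability _ _ _ _ _ _ (\bigcup_j preimage_set_system
  [set: prod_space T] (fun x => x j) measurable)) => //.
move=> _ [_ [j _ [A mA <-]] <-]; rewrite !setTI.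
suff mj : measurable_fun setT (fun yz => glue yz j).
  by rewrite -[X in measurable X]setTI; exact: mj.
have [Pj|nPj] := boolP (P j).
- rewrite (_ : (fun _ => _) = (fun yz => yz.1 (exist _ j Pj))).
    apply: (@measurableT_comp _ _ _ _ _ _
      (fun y : sub_space T P => y (exist _ j Pj)) _ fst) => //.
    exact: measurable_prod_space_proj.
  by apply/funext => yz; exact: glue_observed.
- rewrite (_ : (fun _ => _) = (fun yz => yz.2 (exist _ j nPj))).
    apply: (@measurableT_comp _ _ _ _ _ _
      (fun z : sub_space T (predC P) => z (exist _ j nPj)) _ snd) => //.
    exact: measurable_prod_space_proj.
  by apply/funext => yz; exact: glue_missing.
Qed.

Lemma glue_restrict (x : prod_space T) :
  glue (restrict_sub (P := P) x, restrict_sub (P := predC P) x) = x.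
Proof.
apply: functional_extensionality_dep => j.
by have [Pj|nPj] := boolP (P j); [rewrite glue_observed|rewrite glue_missing].
Qed.

Lemma restrict_glue yz : restrict_sub (P := P) (glue yz) = yz.1.
Proof.
by apply: functional_extensionality_dep => -[j Pj]; rewrite /restrict_sub glue_observed.
Qed.

End glue.

(** * The masked update *)

Section masked_update.
Context (R : realType) (d1 d2 : nat) (S : 'I_d2 -> pointedType).
Local Notation X := (data_space R d1 S).
Local Notation masks := (obs_mask (d1 + d2)).
Variables (M : {set masks}) (mu : masks -> R).
Hypotheses (mu_gt0 : forall m, m \in M -> (0 < mu m)%R)
  (mu_sum1 : (\sum_(m in M) mu m = 1)%R).
Implicit Types (pstar p r : probability X R).

(** Each mask contributes the density [g m] composed with [obs m], whichever version [k m] of the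
    conditional law is chosen, and the mixture is linear in these contributions. *)
Lemma update_density pstar p p' (g : forall m, @observed R d1 d2 S m -> R) :
  is_update M mu pstar p p' ->
  (forall m, measurable_fun setT (g m)) -> (forall m y, (0 <= g m y)%R) ->
  (forall m, m \in M -> is_density (marginal pstar m) (marginal p m) (g m)) ->
  is_density p' p (fun x => \sum_(m in M) mu m * g m (@obs R d1 d2 S m x))%R.
Proof.
move=> [k [pk p'E]] mg g0 gE.
have mgo m : measurable_fun [set: X] (fun x => g m (@obs R d1 d2 S m x)).
  by apply: measurableT_comp => //; exact: mg.
split.
- under eq_fun do rewrite big_mkcond/=.
  apply: measurable_sum => m; case: (m \in M) => //.
  exact: measurable_funM.
- by move=> x; apply: sumr_ge0 => m mM; rewrite mulr_ge0// ltW// mu_gt0.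
- move=> A mA; apply: (etrans (p'E A mA)).
  under [RHS]eq_integral do rewrite -sumEFin big_mkcond/=.
  rewrite ge0_integral_sum//; last 2 first.
  + move=> m; case: (m \in M) => //.
    exact/measurable_funTS/measurable_EFinP/measurable_funM.
  + by move=> m x _; case: ifPn => // mM; rewrite lee_fin mulr_ge0// ltW// mu_gt0.
  rewrite big_mkcond/=; apply: eq_bigr => m _; case: ifPn => mM.
  + under [RHS]eq_integral do rewrite EFinM.
    rewrite ge0_integralZl//; last 3 first.
    * exact/measurable_funTS/measurable_EFinP.
    * by move=> x _; rewrite lee_fin.
    * by rewrite lee_fin ltW// mu_gt0.
    congr (_ * _).
    rewrite -(@integral_density_disintegration _ _ _ _ _ _ _ (@obs R d1 d2 S m)
      (@mis R d1 d2 S m) (@glue _ _ _ m) _ _ _ p (k m) _ (marginal pstar m))//.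
    * by apply: eq_integral => y _; rewrite xsectionE.
    * exact: measurable_glue.
    * by move=> x; exact: glue_restrict.
    * by move=> yz; exact: restrict_glue.
    * exact: pk.
    * exact: gE.
  + by rewrite integral0.
Qed.

Lemma KL_update pstar r p p' : compatible M pstar r ->
  is_update M mu pstar p p' -> KL r p < +oo ->
  [/\ KL r p' < +oo,
    forall m, m \in M -> KL (marginal pstar m) (marginal p m) < +oo &
    KL r p' + \sum_(m in M) (mu m)%:E * KL (marginal pstar m) (marginal p m)
    <= KL r p].
Proof.
move=> rE up rp; have /null_content_dominatesP dom := KL_lty_dominates rp.
have : forall m, exists g : @observed R d1 d2 S m -> R,
    [/\ measurable_fun setT g, forall y, (0 <= g y)%R &
        m \in M -> is_density (marginal pstar m) (marginal p m) g].
  move=> m; case mM : (m \in M); last first.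
    by exists (cst 0%R); split.
  have [|g gE] := @density_exists _ _ _ (marginal pstar m) (marginal p m).
    (* The marginal of [pstar] is that of [r], and domination of [r] by [p] passes to marginals. *)
    apply/null_content_dominatesP => A mA pA.
    apply: etrans (esym (rE _ mM A mA)) _; apply: dom => //.
    by rewrite -[X in measurable X]setTI; exact: measurable_funP.
  by exists g; case: (gE).
move=> /fin_all_exists[g gP].
apply: (@KL_descent _ _ _ _ _ (@observed R d1 d2 S) (@obs R d1 d2 S) M mu
  mu_gt0 mu_sum1 (marginal pstar) r p p' _ g) => //.
- by move=> m mM; have [_ _ gE] := gP m; exact: gE.
- by apply: (update_density up) => m; have [h1 h2 h3] := gP m; assumption.
Qed.

End masked_update.

(** * Convergence of the marginal divergences *)

Theorem theorem1 (R : realType) (d1 d2 : nat) (S : 'I_d2 -> pointedType)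
  (S_finite : forall l, finite_set [set: S l])
  (pstar : probability (data_space R d1 S) R)
  (M : {set obs_mask (d1 + d2)}) (mu : obs_mask (d1 + d2) -> R)
  (mu_gt0 : forall m, m \in M -> (0 < mu m)%R)
  (mu_sum1 : (\sum_(m in M) mu m = 1)%R)
  (p : nat -> probability (data_space R d1 S) R)
  (p0_finite : exists2 r, compatible M pstar r & KL r (p 0%N) < +oo)
  (p_update : forall n, is_update M mu pstar (p n) (p n.+1)) :
  forall m, m \in M ->
    KL (marginal pstar m) (marginal (p n) m) @[n --> \oo] --> 0.
Proof.
move=> m mM; have [r rE r0] := p0_finite.
have r_fin n : KL r (p n) < +oo.
  elim: n => // n IH.
  by have [] := KL_update mu_gt0 mu_sum1 rE (p_update n) IH.
pose a n := fine (KL r (p n)).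
have aE n : KL r (p n) = (a n)%:E by rewrite fineK// ge0_fin_numE// KL_ge0.
pose b n := fine (KL (marginal pstar m) (marginal (p n) m)).
have bE n : KL (marginal pstar m) (marginal (p n) m) = (b n)%:E.
  have [_ fin _] := KL_update mu_gt0 mu_sum1 rE (p_update n) (r_fin n).
  by rewrite fineK// ge0_fin_numE ?KL_ge0 ?fin.
have b0 n : (0 <= b n)%R by rewrite -lee_fin -bE KL_ge0.
have ab n : (a n.+1 + mu m * b n <= a n)%R.
  have [_ _] := KL_update mu_gt0 mu_sum1 rE (p_update n) (r_fin n).
  (* The terms of the masks other than [m] are nonnegative and are dropped. *)
  rewrite !aE (bigD1 m)//= bE => le_a; rewrite -lee_fin; apply: le_trans le_a.
  rewrite EFinD EFinM leeD2l// leeDl//; apply: sume_ge0 => i /andP[iM _].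
  by rewrite mule_ge0 ?KL_ge0// lee_fin ltW// mu_gt0.
have a_cvg : cvgn a.
  apply: nonincreasing_is_cvgn.
    apply/nonincreasing_seqP => n; apply: le_trans (ab n).
    by rewrite lerDl mulr_ge0// ltW// mu_gt0.
  by exists 0%R => _ [n _ <-]; rewrite -lee_fin -aE KL_ge0.
under eq_fun do rewrite bE.
apply/fine_cvgP; split; first by near=> n.
(* By [ab], [b n] is at most the decrement of [a] divided by [mu m]; the decrements of a convergent
   sequence tend to 0. *)
apply: (@squeeze_cvgr _ _ _ _ (cst 0%R) (fun n => (mu m)^-1 * (a n - a n.+1))%R).
- near=> n; rewrite b0 /= ler_pdivlMl ?mu_gt0//.
  by rewrite lerBrDl ab.
- exact: cvg_cst.
- rewrite -[X in _ --> X](mulr0 (mu m)^-1%R); apply: cvgMr.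
  rewrite -(subrr (limn a)); apply: cvgB => //.
  by rewrite cvg_shiftS.
Unshelve. all: by end_near.
Qed.
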